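(* Every $3$-Lie superalgebra over $\mathbb{C}$ whose super vector space dimension is $0|2$ or $1|2$ is either Abelian or isomorphic to a $3$-Lie superalgebra $\mathfrak{h}$ (of the same dimension) whose non-trivial commutation relations are one of the following: $$\text{(i)}\quad \begin{cases} [f_1,f_1,f_1] = -f_1+f_2,\\ [f_1,f_1,f_2] = -f_1+f_2,\\ [f_1,f_2,f_2] = -f_1+f_2,\\ [f_2,f_2,f_2] = -f_1+f_2, \end{cases} \qquad\text{or}\qquad \text{(ii)}\quad [f_1,f_1,f_1] = f_2,$$ where $f_1,f_2$ are the odd generators of $\mathfrak{h}$.
   Context: A super vector space $V = V_{\overline 0} \oplus V_{\overline 1}$ has dimension $m|n$ if $\dim V_{\overline 0}=m$ and $\dim V_{\overline 1}=n$. A homogeneous element $x$ has parity $|x|=\overline 0$ if $x\in V_{\overline 0}$ and $|x|=\overline 1$ if $x\in V_{\overline 1}$. A $3$-Lie superalgebra over $\mathbb{C}$ is a super vector space $\mathfrak{g}$ over $\mathbb{C}$ with a trilinear map $[\cdot,\cdot,\cdot]:\mathfrak{g}^3\to\mathfrak{g}$ such that for all homogeneous elements: (1) $|[x_1,x_2,x_3]| = |x_1|+|x_2|+|x_3|$; (2) $[x_1,x_2,x_3] = -(-1)^{|x_1||x_2|}[x_2,x_1,x_3]$ and $[x_1,x_2,x_3] = -(-1)^{|x_2||x_3|}[x_1,x_3,x_2]$; (3) $[y_1,y_2,[x_1,x_2,x_3]] = [[y_1,y_2,x_1],x_2,x_3] + (-1)^{|x_1|(|y_1|+|y_2|)}[x_1,[y_1,y_2,x_2],x_3]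 + (-1)^{(|x_1|+|x_2|)(|y_1|+|y_2|)}[x_1,x_2,[y_1,y_2,x_3]]$. It is Abelian if its bracket is identically zero. Isomorphisms are parity-preserving linear bijections respecting the brackets. The generators of a $3$-Lie superalgebra of dimension $m|n$ are a basis $e_1,\dots,e_m$ of the even part together with a basis $f_1,\dots,f_n$ of the odd part. Giving the ''non-trivial commutation relations'' means that all brackets of basis elements that do not follow from the listed ones by the graded skew-symmetry (2) are zero (in dimension $1|2$, all brackets involving the even generator $e_1$ are therefore zero). *)

(* Defs.v *)
From HB Require Import structures.
From mathcomp Require Import all_boot all_order all_algebra.
From mathcomp Require Import reals complex.

Set Implicit Arguments.
Unset Strict Implicit.
Unset Printing Implicit Defensive.

Import Order.TTheory GRing.Theory Num.Theory.
Local Open Scope ring_scope.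

(* Parities are booleans: false is even, true is odd, so that addition of     *)
(* parities is (+) and multiplication of parities is &&.                      *)
Record super_vect (K : fieldType) := SuperVect {
  sv_carrier :> vectType K;
  sv_part : bool -> {vspace sv_carrier};
  sv_part_sum : (sv_part false + sv_part true)%VS = fullv;
  sv_part_cap : (sv_part false :&: sv_part true)%VS = 0%VS
}.

Definition has_sdim (K : fieldType) (V : super_vect K) (m n : nat) : Prop :=
  \dim (sv_part V false) = m /\ \dim (sv_part V true) = n.

(* The sign rules are quantified over all parities p with x \in sv_part V p,  *)
(* so that 0 is homogeneous of both parities; the rules are trivial for it.   *)
Record lie3_superalg (K : fieldType) := Lie3Superalg {
  l3_space :> super_vect K;
  l3_br : l3_space -> l3_space -> l3_space -> l3_space;
  l3_linear1 : forall y z, linear (fun x => l3_br x y z);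
  l3_linear2 : forall x z, linear (fun y => l3_br x y z);
  l3_linear3 : forall x y, linear (fun z => l3_br x y z);
  l3_parity : forall p1 p2 p3 x1 x2 x3,
    x1 \in sv_part l3_space p1 -> x2 \in sv_part l3_space p2 ->
    x3 \in sv_part l3_space p3 ->
    l3_br x1 x2 x3 \in sv_part l3_space (p1 (+) p2 (+) p3);
  l3_skew12 : forall p1 p2 p3 x1 x2 x3,
    x1 \in sv_part l3_space p1 -> x2 \in sv_part l3_space p2 ->
    x3 \in sv_part l3_space p3 ->
    l3_br x1 x2 x3 = - ((-1) ^+ (p1 && p2) *: l3_br x2 x1 x3);
  l3_skew23 : forall p1 p2 p3 x1 x2 x3,
    x1 \in sv_part l3_space p1 -> x2 \in sv_part l3_space p2 ->
    x3 \in sv_part l3_space p3 ->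
    l3_br x1 x2 x3 = - ((-1) ^+ (p2 && p3) *: l3_br x1 x3 x2);
  l3_fundamental : forall q1 q2 p1 p2 p3 y1 y2 x1 x2 x3,
    y1 \in sv_part l3_space q1 -> y2 \in sv_part l3_space q2 ->
    x1 \in sv_part l3_space p1 -> x2 \in sv_part l3_space p2 ->
    x3 \in sv_part l3_space p3 ->
    l3_br y1 y2 (l3_br x1 x2 x3) =
      l3_br (l3_br y1 y2 x1) x2 x3
      + (-1) ^+ (p1 && (q1 (+) q2)) *: l3_br x1 (l3_br y1 y2 x2) x3
      + (-1) ^+ ((p1 (+) p2) && (q1 (+) q2)) *: l3_br x1 x2 (l3_br y1 y2 x3)
}.

Definition abelian3 (K : fieldType) (g : lie3_superalg K) : Prop :=
  forall x y z : g, l3_br x y z = 0.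

Definition lie3_isomorphic (K : fieldType) (g h : lie3_superalg K) : Prop :=
  exists phi : {linear g -> h},
    [/\ bijective phi,
        forall p x, x \in sv_part g p -> phi x \in sv_part h p
      & forall x y z, phi (l3_br x y z) = l3_br (phi x) (phi y) (phi z)].

Definition is_generators (K : fieldType) (g : lie3_superalg K) (m n : nat)
    (e : m.-tuple g) (f : n.-tuple g) : Prop :=
  basis_of (sv_part g false) e /\ basis_of (sv_part g true) f.

(* Names of the generators: inl i stands for e_i and inr j for f_j.           *)
Definition gen (m n : nat) : Type := ('I_m + 'I_n)%type.

Definition gen_val (K : fieldType) (g : lie3_superalg K) (m n : nat)
    (e : m.-tuple g) (f : n.-tuple g) (a : gen m n) : g :=
  match a with inl i => tnth e i | inr j => tnth f j end.

(* An entry (a, b, c, v) is the relation [a, b, c] = v. A bracket of          *)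
(* generators is determined by a listed one through graded skew-symmetry      *)
(* exactly when its arguments are a rearrangement of the listed arguments.    *)
Definition nontrivial_relations (K : fieldType) (g : lie3_superalg K)
    (m n : nat) (e : m.-tuple g) (f : n.-tuple g)
    (rels : seq (gen m n * gen m n * gen m n * g)) : Prop :=
  let val := gen_val e f in
  (forall a b c v, (a, b, c, v) \in rels ->
     l3_br (val a) (val b) (val c) = v) /\
  (forall a b c,
     (forall a' b' c' v, (a', b', c', v) \in rels ->
        ~~ perm_eq [:: a; b; c] [:: a'; b'; c']) ->
     l3_br (val a) (val b) (val c) = 0).

Definition relations_i (K : fieldType) (g : lie3_superalg K) (m : nat)
    (f : 2.-tuple g) : seq (gen m 2 * gen m 2 * gen m 2 * g) :=
  let F1 : gen m 2 := inr ord0 in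
  let F2 : gen m 2 := inr ord_max in
  let f1 := tnth f ord0 in
  let f2 := tnth f ord_max in
  [:: (F1, F1, F1, - f1 + f2);
      (F1, F1, F2, - f1 + f2);
      (F1, F2, F2, - f1 + f2);
      (F2, F2, F2, - f1 + f2)].

Definition relations_ii (K : fieldType) (g : lie3_superalg K) (m : nat)
    (f : 2.-tuple g) : seq (gen m 2 * gen m 2 * gen m 2 * g) :=
  let F1 : gen m 2 := inr ord0 in
  let f2 := tnth f ord_max in
  [:: (F1, F1, F1, f2)].

(* Main.v *)
Require Import Defs.
From HB Require Import structures.
From mathcomp Require Import all_boot all_order all_algebra.
From mathcomp Require Import boolp.
From mathcomp Require Import reals complex.

(** A non-Abelian algebra has generators that satisfy the relations (ii), so
    it can itself serve as [h].  The relations (i) define the same algebra in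
    another basis: there the odd bracket is [l x * l y * l z *: w] with
    [w = - f1 + f2], [l] linear, [l f1 = l f2 = 1] and hence [l w = 0], so that
    [f1] and [w] satisfy (ii).

    The even part is spanned by one vector [e], so two even arguments kill a
    bracket by skew-symmetry, and [e, x, x] = b e for odd [x].  Put
    q = [x, x, x].  That the operator [x, x, -] is a derivation of [e, x, x]
    gives 2 [e, x, q] = 0, while that [e, x, -] is a derivation of [x, x, x]
    gives [e, x, q] = 3 b^2 e.  Hence b^2 e = 0, so [e, x, x] = 0, and
    polarization kills every bracket with an even argument
    ([br_even_eq0]).

    On the odd part the bracket is a symmetric trilinear map.  By polarization,
    either it vanishes, and the algebra is Abelian ([abelian3_of_cubes]), or
    some odd [y] has w = [y, y, y] nonzero.  The derivation D = [y, y, -] sends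
    [y] to [w], and D w = 3 D w, hence D w = 0; in particular [y] is not a
    multiple of [w], and [y, w] is a basis of the odd part.  Applying [D] to
    [y, y, w] = 0 and then to [y, w, w] = 0 shows that all brackets of [y] and
    [w] other than [y, y, y] vanish ([cube_relations]). *)

Set Implicit Arguments.
Unset Strict Implicit.
Unset Printing Implicit Defensive.

Import Order.TTheory GRing.Theory Num.Theory.
Local Open Scope ring_scope.

(** * Trilinearity and graded symmetry *)

Lemma linearDZ0 (K : fieldType) (U V : lmodType K) (f : U -> V) :
  linear f ->
  [/\ {morph f : x y / x + y}, forall a, {morph f : x / a *: x} & f 0 = 0].
Proof.
move=> lf.
have f0 : f 0 = 0.
  have := lf 1 0 0; rewrite !scale1r addr0 => /(congr1 (fun v => v - f 0)).
  by rewrite addrK subrr.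
split=> // [x y | a x]; first by have := lf 1 x y; rewrite !scale1r.
by have := lf a x 0; rewrite f0 !addr0.
Qed.

Section Bracket.
Variables (K : fieldType) (g : lie3_superalg K).
Implicit Types x y z : g.

Lemma brDl x x' y z : l3_br (x + x') y z = l3_br x y z + l3_br x' y z.
Proof. by have [-> ] := linearDZ0 (l3_linear1 y z). Qed.

Lemma brDm x y y' z : l3_br x (y + y') z = l3_br x y z + l3_br x y' z.
Proof. by have [-> ] := linearDZ0 (l3_linear2 x z). Qed.

Lemma brDr x y z z' : l3_br x y (z + z') = l3_br x y z + l3_br x y z'.
Proof. by have [-> ] := linearDZ0 (l3_linear3 x y). Qed.

Lemma brZl a x y z : l3_br (a *: x) y z = a *: l3_br x y z.
Proof. by have [_ -> ] := linearDZ0 (l3_linear1 y z). Qed.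

Lemma brZm a x y z : l3_br x (a *: y) z = a *: l3_br x y z.
Proof. by have [_ -> ] := linearDZ0 (l3_linear2 x z). Qed.

Lemma brZr a x y z : l3_br x y (a *: z) = a *: l3_br x y z.
Proof. by have [_ -> ] := linearDZ0 (l3_linear3 x y). Qed.

Lemma br0r x y : l3_br x y (0 : g) = 0.
Proof. by have [_ _ ->] := linearDZ0 (l3_linear3 x y). Qed.

Lemma homogeneous_decomposition x :
  exists2 x0, x0 \in sv_part g false &
    exists2 x1, x1 \in sv_part g true & x = x0 + x1.
Proof.
have : x \in (sv_part g false + sv_part g true)%VS by rewrite sv_part_sum memvf.
by case/memv_addP=> x0 h0 [x1 h1 ->]; exists x0 => //; exists x1.
Qed.

Lemma br_even_odd_odd e x y :
  e \in sv_part g false -> x \in sv_part g true -> y \in sv_part g true ->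
  [/\ l3_br e y x = l3_br e x y, l3_br x e y = - l3_br e x y
    & l3_br x y e = l3_br e x y].
Proof.
move=> he hx hy; split.
- by rewrite (l3_skew23 he hy hx) expr1 scaleN1r opprK.
- by rewrite (l3_skew12 hx he hy) expr0 scale1r.
- rewrite (l3_skew23 hx hy he) expr0 scale1r (l3_skew12 hx he hy).
  by rewrite expr0 scale1r opprK.
Qed.

Lemma br_oddC12 x y z :
  x \in sv_part g true -> y \in sv_part g true -> z \in sv_part g true ->
  l3_br x y z = l3_br y x z.
Proof.
by move=> hx hy hz; rewrite (l3_skew12 hx hy hz) expr1 scaleN1r opprK.
Qed.

Lemma br_oddC23 x y z :
  x \in sv_part g true -> y \in sv_part g true -> z \in sv_part g true ->
  l3_br x y z = l3_br x z y.
Proof.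
by move=> hx hy hz; rewrite (l3_skew23 hx hy hz) expr1 scaleN1r opprK.
Qed.

(** The operator [y1, y2, -] of two odd vectors is even, so it is a derivation
    without signs. *)
Lemma br_odd_derivation y1 y2 x1 x2 x3 :
  y1 \in sv_part g true -> y2 \in sv_part g true ->
  x1 \in sv_part g true -> x2 \in sv_part g true -> x3 \in sv_part g true ->
  l3_br y1 y2 (l3_br x1 x2 x3) =
    l3_br (l3_br y1 y2 x1) x2 x3 + l3_br x1 (l3_br y1 y2 x2) x3
    + l3_br x1 x2 (l3_br y1 y2 x3).
Proof.
move=> hy1 hy2 hx1 hx2 hx3.
by rewrite (l3_fundamental hy1 hy2 hx1 hx2 hx3) /= !expr0 !scale1r.
Qed.

Hypothesis two_neq0 : (2 : K) != 0.
Hypothesis three_neq0 : (3 : K) != 0.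

(** * Polarization of odd brackets *)

Lemma double_eq0 x : x + x = 0 -> x = 0.
Proof.
rewrite -mulr2n -scaler_nat => /eqP.
by rewrite scaler_eq0 (negbTE two_neq0) => /eqP.
Qed.

Lemma triple_eq0 x : x + x + x = 0 -> x = 0.
Proof.
have -> : x + x + x = (3 : K) *: x by rewrite scaler_nat !mulrS mulr0n addr0 addrA.
by move=> /eqP; rewrite scaler_eq0 (negbTE three_neq0) => /eqP.
Qed.

(** Polarization of the quadratic map [x |-> [u, x, x]]. *)
Lemma polarize_br2 u :
  (forall x y, x \in sv_part g true -> y \in sv_part g true ->
     l3_br u x y = l3_br u y x) ->
  (forall x, x \in sv_part g true -> l3_br u x x = 0) ->
  forall x y, x \in sv_part g true -> y \in sv_part g true -> l3_br u x y = 0.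
Proof.
move=> sym sq0 x y hx hy; apply: double_eq0.
have := sq0 _ (memvD hx hy).
by rewrite brDm !brDr !sq0 // add0r addr0 [l3_br u y x]sym.
Qed.

(** Polarization of the cubic map [x |-> [x, x, x]]: the cubes of [x + y] and
    [x - y] give 3 ([x, x, y] + [x, y, y]) = 0 and
    3 ([x, y, y] - [x, x, y]) = 0, hence [x, y, y] = 0. *)
Lemma polarize_br3 :
  (forall x, x \in sv_part g true -> l3_br x x x = 0) ->
  forall x y z, x \in sv_part g true -> y \in sv_part g true ->
    z \in sv_part g true -> l3_br x y z = 0.
Proof.
move=> cube0 x y z hx.
suff sum0 u v : u \in sv_part g true -> v \in sv_part g true ->
    l3_br u u v + l3_br u v v = 0.
  apply: polarize_br2 => [u v hu hv | v hv]; first exact: br_oddC23.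
  apply: double_eq0.
  have hNv : - v \in sv_part g true by rewrite memvN.
  have := sum0 _ _ hx hNv; rewrite -scaleN1r !(brZm, brZr) !scaleN1r opprK.
  move=> eN; have := congr2 (fun a b : g => a + b) (sum0 _ _ hx hv) eN.
  by rewrite addrACA subrr add0r addr0.
move=> hu hv; apply: triple_eq0.
have := cube0 _ (memvD hu hv).
rewrite brDl !brDm !brDr !cube0 // add0r addr0.
rewrite (br_oddC23 hu hv hu) (br_oddC12 hv hu hu) (br_oddC23 hu hv hu).
rewrite (br_oddC12 hv hu hv) (br_oddC23 hv hv hu) (br_oddC12 hv hu hv).
set a := l3_br u u v; set b := l3_br u v v => E; rewrite -[RHS]E.
rewrite !addrA; congr (_ + _); rewrite -!addrA; congr (_ + _).
by rewrite !addrA addrC !addrA; congr (_ + _); rewrite addrC addrA.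
Qed.

(** * Brackets with an even argument *)

Section EvenLine.
Hypothesis even_line : (\dim (sv_part g false) <= 1)%N.

Lemma even_generator :
  exists2 e0, e0 \in sv_part g false &
    forall e, e \in sv_part g false -> exists a, e = a *: e0.
Proof.
move: even_line; rewrite leq_eqVlt ltnS leqn0 => /orP[/eqP d1|].
  exists (vpick (sv_part g false)); first exact: memv_pick.
  move=> e he; apply/vlineP.
  suff -> : <[vpick (sv_part g false)]>%VS = sv_part g false by [].
  apply/eqP; rewrite eqEdim -memvE memv_pick d1 dim_vline vpick0.
  by rewrite -dimv_eq0 d1.
rewrite dimv_eq0 => /eqP->; exists 0; first exact: mem0v.
by move=> e; rewrite memv0 => /eqP->; exists 0; rewrite scaler0.
Qed.

Lemma br_even_even_eq0 p e e' z :
  e \in sv_part g false -> e' \in sv_part g false -> z \in sv_part g p ->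
  l3_br e e' z = 0.
Proof.
have [e0 he0 gen0] := even_generator.
move=> /gen0[a ->] /gen0[b ->] hz; rewrite brZl brZm.
suff -> : l3_br e0 e0 z = 0 by rewrite !scaler0.
apply: double_eq0; rewrite {1}(l3_skew12 he0 he0 hz) expr0 scale1r.
exact: addNr.
Qed.

(** Two fundamental identities evaluate [e, x, [x, x, x]] as 0 and as 3 b^2 e,
    where [e, x, x] = b e; so b^2 e = 0, which forces b e = 0. *)
Lemma br_even_odd_sq_eq0 e x :
  e \in sv_part g false -> x \in sv_part g true -> l3_br e x x = 0.
Proof.
have [e0 he0 gen0] := even_generator.
move=> /gen0[a ->] hx; rewrite brZl.
suff -> : l3_br e0 x x = 0 by rewrite scaler0.
have [b eb] := gen0 _ (l3_parity he0 hx hx).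
have [_ xex xxe] := br_even_odd_odd he0 hx hx.
have hq : l3_br x x x \in sv_part g true := l3_parity hx hx hx.
have [sq _ _] := br_even_odd_odd he0 hx hq.
have q0 : l3_br e0 x (l3_br x x x) = 0.
  have := l3_fundamental hx hx he0 hx hx.
  rewrite /= !expr0 !scale1r xxe eb brZl brZr xxe sq -addrA => /eqP.
  rewrite -[X in X == _]addr0 (inj_eq (addrI _)) eq_sym.
  by move=> /eqP/double_eq0.
have := l3_fundamental he0 hx hx hx hx.
rewrite q0 /= expr0 expr1 scale1r scaleN1r eb brZl brZm brZr xex xxe.
rewrite scalerN opprK => /esym/triple_eq0/eqP.
rewrite eb scalerA scaler_eq0 mulf_eq0 orbb.
by rewrite -scaler_eq0 => /eqP.
Qed.

Lemma br_even_eq0 p q e y z :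
  e \in sv_part g false -> y \in sv_part g p -> z \in sv_part g q ->
  [/\ l3_br e y z = 0, l3_br y e z = 0 & l3_br y z e = 0].
Proof.
move=> he hy hz.
(* Two odd arguments are the only case not settled by br_even_even_eq0. *)
have first0 p' q' y' z' : y' \in sv_part g p' -> z' \in sv_part g q' ->
    l3_br e y' z' = 0.
  case: p' => hy' hz'; last exact: br_even_even_eq0 hz'.
  case: q' hz' => hz'; last by rewrite (l3_skew23 he hy' hz')
                               (br_even_even_eq0 he hz' hy') scaler0 oppr0.
  apply: polarize_br2 => // [u v hu hv | u hu]; last exact: br_even_odd_sq_eq0.
  by have [-> _ _] := br_even_odd_odd he hv hu.
have second0 p' q' y' z' : y' \in sv_part g p' -> z' \in sv_part g q' ->
    l3_br y' e z' = 0.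
  by move=> hy' hz'; rewrite (l3_skew12 hy' he hz') (first0 _ _ _ _ hy' hz')
    scaler0 oppr0.
split; [exact: first0 hy hz | exact: second0 hy hz |].
by rewrite (l3_skew23 hy hz he) (second0 _ _ _ _ hy hz) scaler0 oppr0.
Qed.

Lemma abelian3_of_cubes :
  (forall x, x \in sv_part g true -> l3_br x x x = 0) -> abelian3 g.
Proof.
move=> cube0 x y z.
have [x0 hx0 [x1 hx1 ->]] := homogeneous_decomposition x.
have [y0 hy0 [y1 hy1 ->]] := homogeneous_decomposition y.
have [z0 hz0 [z1 hz1 ->]] := homogeneous_decomposition z.
rewrite brDl !brDm !brDr (polarize_br3 cube0 hx1 hy1 hz1) addr0.
have E0 p q u v w := @br_even_eq0 p q u v w.
have [-> _ _] := E0 _ _ _ _ _ hx0 hy0 hz0.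
have [-> _ _] := E0 _ _ _ _ _ hx0 hy0 hz1.
have [-> _ _] := E0 _ _ _ _ _ hx0 hy1 hz0.
have [-> _ _] := E0 _ _ _ _ _ hx0 hy1 hz1.
have [_ -> _] := E0 _ _ _ _ _ hy0 hx1 hz0.
have [_ -> _] := E0 _ _ _ _ _ hy0 hx1 hz1.
have [_ _ ->] := E0 _ _ _ _ _ hz0 hx1 hy1.
by rewrite !addr0.
Qed.

End EvenLine.

(** * Brackets generated by an odd cube *)

(** The derivation D = [y, y, -] satisfies D w = 3 [w, y, y] = 3 D w, so
    D w = 0; the other two relations are D applied to the previous one. *)
Lemma cube_relations y (w := l3_br y y y) : y \in sv_part g true ->
  [/\ l3_br y y w = 0, l3_br y w w = 0 & l3_br w w w = 0].
Proof.
move=> hy; have hw : w \in sv_part g true := l3_parity hy hy hy.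
have yyw : l3_br y y w = 0.
  apply: double_eq0; have := br_odd_derivation hy hy hy hy hy.
  rewrite -/w (br_oddC12 hw hy hy) (br_oddC23 hy hw hy) -addrA => /eqP.
  by rewrite -[X in X == _]addr0 (inj_eq (addrI _)) eq_sym => /eqP.
have yww : l3_br y w w = 0.
  apply: double_eq0; have := br_odd_derivation hy hy hy hy hw.
  by rewrite -/w yyw !br0r addr0 (br_oddC12 hw hy hw) => /esym.
split=> //; have := br_odd_derivation hy hy hy hw hw.
rewrite -/w yww yyw !br0r addr0 => /esym.
by rewrite (br_oddC23 hy (mem0v _) hw) br0r addr0.
Qed.

(** If [y] were a multiple of w = [y, y, y], then [y, y, w] = 0 would give
    w = 0. *)
Lemma cube_basis y (w := l3_br y y y) : \dim (sv_part g true) = 2%N ->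
  y \in sv_part g true -> w != 0 -> basis_of (sv_part g true) [:: y; w].
Proof.
move=> d2 hy w0; have [yyw _ _] := cube_relations hy.
have hw : w \in sv_part g true := l3_parity hy hy hy.
rewrite basisEfree d2 /= andbT free_cons span_seq1 seq1_free w0 andbT.
apply/andP; split; last by apply/span_subvP => v; rewrite !inE => /orP[] /eqP->.
apply/negP => /vlineP[k ky]; case/eqP: w0.
by rewrite /w {3}ky brZr yyw scaler0.
Qed.

(** By graded symmetry the brackets of [y] and [w] reduce to [y, y, y] and the
    three brackets of [cube_relations]. *)
Lemma cube_relations_ii m (e : m.-tuple g) y :
  (\dim (sv_part g false) <= 1)%N ->
  basis_of (sv_part g false) e -> y \in sv_part g true ->
  nontrivial_relations e [tuple y; l3_br y y y]
    (relations_ii m [tuple y; l3_br y y y]).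
Proof.
move=> d1 be hy; set f := [tuple y; l3_br y y y].
have [yyw yww www] := cube_relations hy; set w := l3_br y y y in f yyw yww www *.
have hw : w \in sv_part g true := l3_parity hy hy hy.
have he i : tnth e i \in sv_part g false := basis_mem be (mem_tnth i e).
have hf (j : 'I_2) : tnth f j \in sv_part g true.
  by case: j => [[|[|//]]] ?.
have hgen a : exists p, gen_val e f a \in sv_part g p.
  by case: a => i; [exists false; exact: he | exists true; exact: hf].
split=> [a b c v | a b c npe].
  by rewrite inE => /eqP[-> -> -> ->].
have {}npe := npe _ _ _ _ (mem_head _ _).
have [[p ha] [q hb] [r hc]] := And3 (hgen a) (hgen b) (hgen c).
case: a ha npe => [i | a] ha npe.
  by have [] := br_even_eq0 d1 (he i) hb hc.
case: b hb npe => [i | b] hb npe.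
  by have [] := br_even_eq0 d1 (he i) ha hc.
case: c hc npe => [i | c] hc npe.
  by have [] := br_even_eq0 d1 (he i) ha hb.
move: npe {p q r ha hb hc}.
have ord2 (j : 'I_2) : j = ord0 \/ j = ord_max.
  by case: j => [[|[|//]]] ?; [left | right]; apply: val_inj.
have [t0 t1] : tnth f ord0 = y /\ tnth f ord_max = w by [].
have [wyy wyw] : l3_br w y y = 0 /\ l3_br w y w = 0.
  by rewrite !(br_oddC12 hw hy) // (br_oddC23 hy hw hy).
have [ywy wwy] : l3_br y w y = 0 /\ l3_br w w y = 0.
  by rewrite (br_oddC23 hy hw hy) (br_oddC23 hw hw hy).
case: (ord2 a) => ->; case: (ord2 b) => ->; case: (ord2 c) => -> //=;
  by rewrite ?(t0, t1) ?perm_refl.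
Qed.

End Bracket.

(** * Classification *)

Theorem theorem4 (R : realType) (m : nat) (hm : m = 0%N \/ m = 1%N)
    (g : lie3_superalg R[i]) (hg : has_sdim g m 2) :
  abelian3 g \/
  exists h : lie3_superalg R[i],
    [/\ has_sdim h m 2,
        lie3_isomorphic g h
      & exists (e : m.-tuple h) (f : 2.-tuple h),
          is_generators e f /\
          (nontrivial_relations e f (relations_i m f) \/
           nontrivial_relations e f (relations_ii m f))].
Proof.
have two0 : (2 : R[i]) != 0 by rewrite pnatr_eq0.
have three0 : (3 : R[i]) != 0 by rewrite pnatr_eq0.
have [dE dO] := hg.
have d1 : (\dim (sv_part g false) <= 1)%N by rewrite dE; case: hm => ->.
have [cube0 | ncube0] :=
  pselect (forall x : g, x \in sv_part g true -> l3_br x x x = 0).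
  by left; apply: abelian3_of_cubes.
right; have [y hy w0] : exists2 y : g, y \in sv_part g true & l3_br y y y != 0.
  apply: contrapT => none; apply: ncube0 => x hx; apply/eqP/negPn/negP => nx.
  by apply: none; exists x.
exists g; split=> //.
  by exists idfun; split=> //; exists idfun.
subst m; exists (vbasis (sv_part g false)), [tuple y; l3_br y y y].
have be := vbasisP (sv_part g false).
split; first by split=> //; exact: cube_basis.
by right; apply: cube_relations_ii.
Qed.
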